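(* Let $\mathbb P$ be a partition, $P_0$ a probability on $\mathcal A(\mathbb P)$, $a\in\mathbb R$, $b>0$, and let $\underline P:\mathcal A(\mathbb P)\to\mathbb R$ be an NL$(a,b)$ lower probability (with respect to $P_0$). If $b+2a\le 1$, then $\underline P$ is 2-coherent on $\mathcal A(\mathbb P)$.
   Context: A partition $\mathbb P$ is an arbitrary (finite or infinite) set of pairwise disjoint non-impossible events (atoms) whose logical sum is the sure event $\Omega$. $\mathcal A(\mathbb P)$ is the set of events logically dependent on $\mathbb P$, i.e. the powerset of $\mathbb P$ (events are identified with sets of atoms); $\emptyset$ is the impossible event. A probability on $\mathcal A(\mathbb P)$ is a finitely additive function $P_0:\mathcal A(\mathbb P)\to[0,1]$ with $P_0(\Omega)=1$ (no countable additivity is required). $I_A$ is the indicator of the event $A$. Given $P_0$, $a\in\mathbb R$ and $b>0$, a function $\mu:\mathcal A(\mathbb P)\to\mathbb R$ is NL$(a,b)$ if $\mu(\emptyset)=0$, $\mu(\Omega)=1$, and for all $A\in\mathcal A(\mathbb P)\setminus\{\emptyset,\Omega\}$, $\mu(A)=\min\{\max\{bP_0(A)+a,0\},1\}$. ''Lower probability'' just means a real-valued map on the set of events, to which consistency notions for lower probabilities are applied. A lower probability $\underline P:\mathcal D\to\mathbb R$ on a set of events $\mathcal D$ is 2-coherent if, for all $s_1\ge 0$, $s_0\in\mathbb R$ and $A_0,A_1\in\mathcal D$, putting $\underline G_2=s_1(I_{A_1}-\underline P(A_1))-s_0(I_{A_0}-\underline P(A_0))$, one has $\max\underline G_2\ge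 0$ (maximum over atoms). *)

(* Defs.v *)
From HB Require Import structures.
From mathcomp Require Import all_boot all_order all_algebra.
From mathcomp Require Import boolp classical_sets reals numfun.

Set Implicit Arguments.
Unset Strict Implicit.
Unset Printing Implicit Defensive.

Import Order.TTheory GRing.Theory Num.Theory.

Local Open Scope classical_set_scope.
Local Open Scope ring_scope.

(* A partition is given by the type T of its atoms (of any cardinality); the
   events logically dependent on it are the subsets of T, the sure event being
   setT and the impossible event set0.  T need not be assumed inhabited: over
   an empty T no function satisfies is_probability, as set0 = setT. *)

Definition is_probability (R : realType) (T : Type) (P0 : set T -> R) : Prop :=
  [/\ forall A, 0 <= P0 A <= 1,
      P0 setT = 1 &
      forall A B, A `&` B = set0 -> P0 (A `|` B) = P0 A + P0 B].

Definition is_NL (R : realType) (T : Type) (P0 : set T -> R) (a b : R)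
    (mu : set T -> R) : Prop :=
  [/\ mu set0 = 0,
      mu setT = 1 &
      forall A, A <> set0 -> A <> setT ->
        mu A = Num.min (Num.max (b * P0 A + a) 0) 1].

Definition is_max (R : realType) (E : set R) (m : R) : Prop :=
  E m /\ ubound E m.

Definition gain2 (R : realType) (T : Type) (lP : set T -> R) (s1 s0 : R)
    (A1 A0 : set T) (w : T) : R :=
  s1 * (\1_A1 w - lP A1) - s0 * (\1_A0 w - lP A0).

(* The values of lP outside the domain D are irrelevant.  A gain takes at most
   four values, so requiring its maximum to exist only excludes an empty T. *)
Definition two_coherent (R : realType) (T : Type) (D : set (set T))
    (lP : set T -> R) : Prop :=
  forall (s1 s0 : R) (A1 A0 : set T), 0 <= s1 -> D A1 -> D A0 ->
    exists2 m, is_max (range (gain2 lP s1 s0 A1 A0)) m & 0 <= m.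

(* Main.v *)
Require Import Defs.
From mathcomp Require Import all_boot all_order all_algebra.
From mathcomp Require Import boolp classical_sets reals.
From mathcomp Require Import numfun.
From mathcomp Require Import lra.

Import Order.TTheory GRing.Theory Num.Theory.

Local Open Scope classical_set_scope.
Local Open Scope ring_scope.

(** A normalized monotone set function [lP] with
    [lP A + lP (~` A) <= 1] for every event [A] is 2-coherent
    ([monotone_two_coherent]): a bet on [A1] against [A0] could only lose at
    every atom if [A1] implied [A0] at a higher price, and a bet in favour of
    both only if the events were disjoint with prices adding up to more than
    [1]; monotonicity excludes the former, and together with the bound on
    complements it excludes the latter.

    Away from the impossible and the sure event, an NL(a,b) function is the
    truncation to [0,1] of an increasing affine function of [P0]; as it takes
    the extreme values 0 and 1 at those two events, it is monotone ([NL_le]).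
    The untruncated values at an event and at its complement add up to
    [b + 2 * a], whatever the event.  When this is at most [1], the truncated
    values do not exceed [1] in total either ([clamp01_add_le1]): raising a
    negative value to 0 leaves at most the other one, which is truncated at 1,
    and otherwise truncation does not increase either of them. *)

Lemma eq_set0_or_ex {T : Type} (A : set T) : A = set0 \/ exists x, A x.
Proof.
by have [|/set0P] := eqVneq A set0; [left | right].
Qed.

Lemma eq_setT_or_ex {T : Type} (A : set T) : A = setT \/ exists x, ~ A x.
Proof.
have [A0|] := eq_set0_or_ex (~` A); last by right.
by left; rewrite -(setCK A) A0 setC0.
Qed.

(** A function that factors through a finite type takes finitely many values,
    so a nonnegative value somewhere makes its maximum nonnegative. *)
Lemma max_range_ge0 {R : realType} {T : Type} {K : finType} (h : T -> K)
    (g : K -> R) (f : T -> R) {w : T} :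
  (forall x, f x = g (h x)) -> 0 <= f w ->
  exists2 m, is_max (range f) m & 0 <= m.
Proof.
move=> fE fw; pose P k := `[< exists x, h x = k >].
have Ph x : P (h x) by apply/asboolP; exists x.
case: (@arg_maxP _ _ _ (h w) P g (Ph w)) => k /asboolP[x hx] kmax.
exists (g k); last by apply: le_trans (kmax _ (Ph w)); rewrite -fE.
split; first by exists x => //; rewrite fE hx.
by move=> _ [y _ <-]; rewrite fE; exact: kmax (Ph y).
Qed.

Lemma gain2_max_ge0 {R : realType} {T : Type} {lP : set T -> R} {s1 s0 : R}
    {A1 A0 : set T} {w : T} :
  0 <= gain2 lP s1 s0 A1 A0 w ->
  exists2 m, is_max (range (gain2 lP s1 s0 A1 A0)) m & 0 <= m.
Proof.
apply: (max_range_ge0 (fun x => (x \in A1, x \in A0))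
  (fun k => s1 * (k.1%:R - lP A1) - s0 * (k.2%:R - lP A0))) => x.
by rewrite /gain2 !indicE.
Qed.

(** A bet on [A] at price [p] against [B] at price [q] can only lose outside
    [A `\` B].  If that set is empty, the atoms that remain
    useful are those of [A] when the stake on [A] is the larger one, and those
    outside [B] when the stake on [B] is; the normalization of the prices covers
    the case in which no such atom exists. *)
Lemma bet_against_ge0 {R : realType} {T : Type} {A B : set T} {p q s t : R}
    (w0 : T) :
  0 <= p <= 1 -> 0 <= q <= 1 ->
  (A = set0 -> p = 0) -> (B = setT -> q = 1) -> (A `<=` B -> p <= q) ->
  0 <= s -> 0 <= t ->
  exists w, 0 <= s * (\1_A w - p) - t * (\1_B w - q).
Proof.
move=> /andP[p0 p1] /andP[q0 q1] pA qB pq s0 t0.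
have [AB|nAB] := pselect (A `<=` B); last first.
  have [w [Aw Bw]] : exists w, A w /\ ~ B w.
    apply: contrapT => h; apply: nAB => w Aw.
    by apply: contrapT => Bw; apply: h; exists w.
  by exists w; rewrite !indicE mem_set // memNset //=; nra.
have {}pq := pq AB.
have [A0|[w1 Aw1]] := eq_set0_or_ex A; have [BT|[w2 Bw2]] := eq_setT_or_ex B.
- by exists w0; rewrite A0 BT !indicE in_set0 in_setT /= (pA A0) (qB BT); lra.
- by exists w2; rewrite A0 !indicE in_set0 (memNset Bw2) /= (pA A0); nra.
- by exists w1; rewrite BT !indicE in_setT mem_set //= (qB BT); nra.
have [ts|/ltW st] := leP t s.
- exists w1; rewrite !indicE mem_set // mem_set /=; last exact: AB.
  have := ler_wpM2r (_ : 0 <= 1 - q) ts; rewrite subr_ge0 => /(_ q1); nra.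
- exists w2; rewrite !indicE !memNset //=; last by move=> /AB.
  have := ler_wpM2r p0 st; nra.
Qed.

(** Betting in favour of [A0] is betting against its complement at the
    conjugate price [1 - lP A0], so both signs of the stake on [A0] reduce to
    [bet_against_ge0]. *)
Lemma monotone_two_coherent {R : realType} {T : Type} {lP : set T -> R} :
  lP set0 = 0 -> lP setT = 1 ->
  (forall A B, A `<=` B -> lP A <= lP B) ->
  (forall A, lP A + lP (~` A) <= 1) ->
  two_coherent [set: set T] lP.
Proof.
move=> l0 l1 lmon lC s1 s0 A1 A0 s1_ge0 _ _.
have l01 A : 0 <= lP A <= 1 by rewrite -{1}l0 -l1 !lmon.
have [T0|[w0 _]] := eq_set0_or_ex [set: T].
  by move: l1; rewrite T0 l0 => /eqP; rewrite eq_sym oner_eq0.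
suff [w] : exists w, 0 <= gain2 lP s1 s0 A1 A0 w by exact: gain2_max_ge0.
have [s0_ge0|/ltW s0_le0] := leP 0 s0.
  by apply: (bet_against_ge0 w0) => // [->|->|]//; exact: lmon.
have [|||||||w p] := @bet_against_ge0 _ _ A1 (~` A0) (lP A1) (1 - lP A0)
    s1 (- s0) w0.
- exact: l01.
- by have := l01 A0; lra.
- by move=> ->.
- by move=> /(congr1 setC); rewrite setCK setCT => ->; rewrite l0 subr0.
- by move=> /lmon le10; have := lC A0; lra.
- exact: s1_ge0.
- by rewrite oppr_ge0.
exists w; move: p; rewrite /gain2 !indicE in_setC.
by case: (w \in A0) => /=; nra.
Qed.

Lemma clamp01_add_le1 {R : realType} {x y : R} :
  x + y <= 1 ->
  Num.min (Num.max x 0) 1 + Num.min (Num.max y 0) 1 <= 1.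
Proof.
by move=> xy; case: (leP x 0) => ?; case: (leP y 0) => ?;
  case: (leP x 1) => ?; case: (leP y 1) => ?; rewrite ?(min_l ler01); lra.
Qed.

Lemma probability_le {R : realType} {T : Type} {P0 : set T -> R} {A B : set T} :
  is_probability P0 -> A `<=` B -> P0 A <= P0 B.
Proof.
move=> [P01 _ PU] AB; rewrite -(setDUK AB) PU ?setDIK//.
by rewrite lerDl; case/andP: (P01 (B `\` A)).
Qed.

Lemma probabilityC {R : realType} {T : Type} {P0 : set T -> R} {A : set T} :
  is_probability P0 -> P0 (~` A) = 1 - P0 A.
Proof.
by move=> [_ PT PU]; rewrite -PT -(setUv A) PU ?setICr// addrC addKr.
Qed.

Lemma NL_le {R : realType} {T : Type} {P0 : set T -> R} {a b : R}
    {mu : set T -> R} {A B : set T} :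
  is_probability P0 -> 0 <= b -> is_NL P0 a b mu -> A `<=` B -> mu A <= mu B.
Proof.
move=> PP b0 [mu0 muT muE] AB.
have mu01 C : 0 <= mu C <= 1.
  have [->|/eqP C0] := pselect (C = set0); first by rewrite mu0 lexx ler01.
  have [->|/eqP CT] := pselect (C = setT); first by rewrite muT ler01 lexx.
  rewrite muE; [|exact/eqP|exact/eqP].
  by rewrite ge_min lexx orbT andbT le_min le_max lexx orbT ler01.
have [->|A0] := pselect (A = set0); first by rewrite mu0; case/andP: (mu01 B).
have [->|BT] := pselect (B = setT); first by rewrite muT; case/andP: (mu01 A).
rewrite !muE//.
- have le_AB : b * P0 A + a <= b * P0 B + a.
    by rewrite lerD2r ler_wpM2l// probability_le.
  by apply: le_min2 => //; apply: le_max2.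
- by move=> B0; apply: A0; rewrite -subset0 -B0.
- by move=> AT; apply: BT; rewrite -subTset -AT.
Qed.

Lemma NL_addC_le1 {R : realType} {T : Type} {P0 : set T -> R} {a b : R}
    {mu : set T -> R} {A : set T} :
  is_probability P0 -> is_NL P0 a b mu -> b + 2 * a <= 1 ->
  mu A + mu (~` A) <= 1.
Proof.
move=> PP [mu0 muT muE] ab.
have [->|A0] := pselect (A = set0); first by rewrite setC0 mu0 muT add0r.
have [->|AT] := pselect (A = setT); first by rewrite setCT mu0 muT addr0.
rewrite !muE//.
- by apply: clamp01_add_le1; rewrite probabilityC//; lra.
- by rewrite -setCT => /setC_inj.
- by rewrite -setC0 => /setC_inj.
Qed.

Theorem proposition3p2 (R : realType) (T : Type) (P0 : set T -> R) (a b : R)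
    (lP : set T -> R) :
  is_probability P0 -> 0 < b -> is_NL P0 a b lP ->
  b + 2 * a <= 1 ->
  two_coherent [set: set T] lP.
Proof.
move=> PP b0 NL ab; case: (NL) => l0 lT _; apply: monotone_two_coherent => //.
- by move=> A B; exact: NL_le PP (ltW b0) NL.
- by move=> A; exact: NL_addC_le1 PP NL ab.
Qed.
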